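(* Let $\phi:X\to Y$ be a map of finite sets and let $f$ be a Plott function on $X$. Then $$\mathrm{Bas}(\phi_*(f))=\phi_*(\mathrm{Bas}(f)),$$ where $\phi_*(\mathrm{Bas}(f))=\{\phi_*(l): l\in \mathrm{Bas}(f)\}$.
   Context: A choice function on $X$ is a map $f:2^X\to 2^X$ with $f(A)\subset A$ for all $A\subset X$ (empty values are allowed). $f$ is a Plott function if $f(A\cup B)=f(f(A)\cup B)$ for all $A,B\subset X$. For choice functions, $f\le g$ means $f(A)\subset g(A)$ for all $A\subset X$. A Plott function $l$ is linear if $l(A)$ contains at most one element for every $A\subset X$. The basement of a choice function $f$ is the set $\mathrm{Bas}(f)$ of all linear Plott functions $l$ (on the same set) with $l\le f$. For a map $\phi:X\to Y$ and a choice function $f$ on $X$, the direct image $\phi_*(f)$ is the choice function on $Y$ given by $\phi_*(f)(B)=\phi(f(\phi^{-1}(B)))$ for $B\subset Y$. *)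

(* Defs.v *)
From HB Require Import structures.
From mathcomp Require Import all_boot.

Set Implicit Arguments.
Unset Strict Implicit.
Unset Printing Implicit Defensive.

(* Bundling the underlying map as a finite function makes Leibniz equality of
   choice functions extensional, and makes choice functions a finType. *)
Record choiceFun (X : finType) := ChoiceFun {
  choice_val :> {ffun {set X} -> {set X}};
  _ : [forall A : {set X}, choice_val A \subset A]
}.

HB.instance Definition _ (X : finType) := [isSub for @choice_val X].
HB.instance Definition _ (X : finType) := [Finite of choiceFun X by <:].

Lemma choice_sub (X : finType) (f : choiceFun X) (A : {set X}) :
  f A \subset A.
Proof. by case: f => f /= /forallP. Qed.

Definition plott (X : finType) (f : choiceFun X) : bool :=
  [forall A : {set X}, forall B : {set X}, f (A :|: B) == f (f A :|: B)].

Definition choice_le (X : finType) (f g : choiceFun X) : bool :=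
  [forall A : {set X}, f A \subset g A].

Definition linear_plott (X : finType) (l : choiceFun X) : bool :=
  plott l && [forall A : {set X}, #|l A| <= 1].

Definition Bas (X : finType) (f : choiceFun X) : {set choiceFun X} :=
  [set l | linear_plott l & choice_le l f].

Definition direct_image_val (X Y : finType) (phi : X -> Y) (f : choiceFun X) :
  {ffun {set Y} -> {set Y}} := [ffun B : {set Y} => phi @: f (phi @^-1: B)].

Lemma direct_image_subproof (X Y : finType) (phi : X -> Y) (f : choiceFun X) :
  [forall B : {set Y}, direct_image_val phi f B \subset B].
Proof.
apply/forallP => B; rewrite ffunE; apply/subsetP => y /imsetP[x xf ->].
by have := subsetP (choice_sub f _) x xf; rewrite inE.
Qed.

Definition direct_image (X Y : finType) (phi : X -> Y) (f : choiceFun X) :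
  choiceFun Y := ChoiceFun (direct_image_subproof phi f).

(* Main.v *)
Require Import Defs.
From mathcomp Require Import all_boot.

(** A Plott function [f] has two consequences that drive everything: heredity
(an element chosen from [B] is still chosen from any smaller set containing it)
and the outcast property (discarding unchosen elements does not change the
choice).

Direct images preserve the Plott property by the outcast property, since the
saturation of [f (phi^-1 A)] along [phi] lies between [f (phi^-1 A)] and
[phi^-1 A]; they also preserve [choice_le] and the bound on cardinals. This
gives one inclusion.

For the other, let [m] be a linear Plott function below [phi_* f]. A word
[x1 x2 ...] in [X] determines the linear Plott function choosing from [A] the
first letter lying in [A], and by heredity this function is below [f] as soon
as each letter is chosen by [f] from the complement of the preceding ones. It
remains to find such a word whose image under [phi], repetitions deleted, lists
the elements of [Y] in the order in which [m] ranks them. One [f]-chosen lift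
of each element does not suffice: other elements of the same fibres may stand
in the way. They are removed greedily: let [S] be the set of points not used so
far and [B] the part of [Y] not yet ranked. If [f S] meets the complement of
[phi^-1 B], append a point there: its image is already ranked, so the word in
[Y] is not affected. Otherwise the outcast property gives
[f S = f (phi^-1 B)], whose image contains the [m]-choice from [B], and a lift
of it can be appended. *)

Set Implicit Arguments.
Unset Strict Implicit.

Section PlottFunctions.

Variables (X : finType) (f : choiceFun X).
Hypothesis f_plott : plott f.

Lemma plottE (A B : {set X}) : f (A :|: B) = f (f A :|: B).
Proof. by move/forallP: f_plott => /(_ A) /forallP/(_ B) /eqP. Qed.

Lemma plott_outcast (A C : {set X}) : f A \subset C -> C \subset A -> f C = f A.
Proof.
by move=> fAC CA; rewrite -(setUidPl CA) plottE (setUidPr fAC).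
Qed.

(** Splitting [B] as [A :|: (B :\: A)] and replacing [A] by [f A] shows that the
only elements of [A] that can be chosen from [B] are those of [f A]. *)
Lemma plott_heredity (A B : {set X}) (x : X) :
  A \subset B -> x \in A -> x \in f B -> x \in f A.
Proof.
move=> AB xA; rewrite -[B](setID _ A) (setIidPr AB) plottE => xf.
by have := subsetP (choice_sub f _) x xf; rewrite !inE xA orbF.
Qed.

End PlottFunctions.

Section DirectImage.

Variables (X Y : finType) (phi : X -> Y).

Lemma direct_imageE (f : choiceFun X) (B : {set Y}) :
  direct_image phi f B = phi @: f (phi @^-1: B).
Proof. by rewrite /direct_image /= ffunE. Qed.

Lemma direct_image_plott (f : choiceFun X) :
  plott f -> plott (direct_image phi f).
Proof.
move=> f_plott; apply/forallP => A; apply/forallP => B; apply/eqP.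
rewrite !direct_imageE !preimsetU; congr (phi @: _).
(* [C] lies between [f (phi @^-1: A)] and [phi @^-1: A] *)
set C := phi @^-1: (phi @: _).
have fC : f C = f (phi @^-1: A).
  apply: plott_outcast => //.
    by apply/subsetP => x xf; rewrite inE imset_f.
  apply/subsetP => x; rewrite !inE => /imsetP[z zf ->].
  by have := subsetP (choice_sub f _) z zf; rewrite inE.
by rewrite (plottE f_plott) -fC -plottE.
Qed.

Lemma direct_image_Bas (f l : choiceFun X) :
  l \in Bas f -> direct_image phi l \in Bas (direct_image phi f).
Proof.
rewrite !inE => /andP[/andP[l_plott /forallP l1] /forallP lf].
apply/andP; split; last by apply/forallP=> B; rewrite !direct_imageE imsetS.
rewrite /linear_plott direct_image_plott //=; apply/forallP => B.
by rewrite direct_imageE (leq_trans (leq_imset_card _ _)).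
Qed.

End DirectImage.

Section Words.

Variable X : finType.
Implicit Types (s : seq X) (A B : {set X}).

Fixpoint first_letter s A : {set X} :=
  if s is x :: s' then if x \in A then [set x] else first_letter s' A
  else set0.

Lemma first_letter_sub s A : first_letter s A \subset A.
Proof.
elim: s => [|x s IHs] /=; first exact: sub0set.
by case: ifP => // xA; rewrite sub1set.
Qed.

Lemma word_choice_subproof s :
  [forall A : {set X}, [ffun A => first_letter s A] A \subset A].
Proof. by apply/forallP => A; rewrite ffunE first_letter_sub. Qed.

Definition word_choice s : choiceFun X := ChoiceFun (word_choice_subproof s).

Lemma word_choiceE s A : word_choice s A = first_letter s A.
Proof. by rewrite /word_choice /= ffunE. Qed.

Lemma word_choice_linear s : linear_plott (word_choice s).
Proof.
apply/andP; split; last first.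
  apply/forallP => A; rewrite word_choiceE.
  elim: s => [|x s IHs] /=; first by rewrite cards0.
  by case: ifP => // _; rewrite cards1.
apply/forallP => A; apply/forallP => B; rewrite !word_choiceE; apply/eqP.
elim: s => [|x s IHs] //=; rewrite !inE; case: ifP => [|/norP[/negbTE xA /negbTE xB]].
  by case: (x \in A) => [_|/= ->]; rewrite ?set11 ?orbT.
rewrite xA xB orbF ifN //; apply/negP => /(subsetP (first_letter_sub s A)).
by rewrite xA.
Qed.

End Words.

Section LinearLift.

Variables (X Y : finType) (phi : X -> Y) (f : choiceFun X) (m : choiceFun Y).
Hypotheses (f_plott : plott f) (m_Bas : m \in Bas (direct_image phi f)).

(** The greedy construction, generalized to a set [S] of points still available
and a set [B] of values still to be ranked; each step removes a point of [S]. *)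
Lemma linear_lift_word (S : {set X}) (B : {set Y}) : phi @^-1: B \subset S ->
  exists s : seq X,
    (forall A : {set X}, A \subset S -> first_letter s A \subset f A) /\
    (forall C : {set Y}, C \subset B ->
       phi @: first_letter s (phi @^-1: C) = m C).
Proof.
move: (m_Bas); rewrite inE.
case/andP=> /andP[m_plott /forallP m_card] /forallP m_le.
have [n] := ubnP #|S|; elim: n S B => // n IHn S B leSn BS.
have card_step x : x \in f S -> #|S :\ x| < n.
  move/(subsetP (choice_sub f S)) => xS.
  by move: leSn; rewrite (cardsD1 x) xS.
(* prepending a letter chosen from [S] keeps the word below [f] *)
have cons_le x s : x \in f S ->
    (forall A : {set X}, A \subset S :\ x -> first_letter s A \subset f A) ->
  forall A : {set X}, A \subset S -> first_letter (x :: s) A \subset f A.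
  move=> xf sf A AS /=; case: ifP => xA.
    by rewrite sub1set (plott_heredity f_plott AS).
  by apply: sf; rewrite subsetD1 AS xA.
have [mB0|[y ymB]] := set_0Vmem (m B).
  exists [::]; split=> [A _|C CB] /=; first exact: sub0set.
  by rewrite imset0; rewrite (@plott_outcast _ m m_plott B C) ?mB0 ?sub0set.
have [fSB|/subsetPn[x xf]] := boolP (f S \subset phi @^-1: B); last first.
  rewrite inE => xB.
  have [|s [sf sm]] := IHn (S :\ x) B (card_step x xf).
    by rewrite subsetD1 BS inE.
  exists (x :: s); split=> [|C CB]; first exact: cons_le.
  rewrite /= inE ifN ?sm //.
  by apply: contra xB; apply: (subsetP CB).
have /imsetP[x xf yE] : y \in phi @: f S.
  rewrite -(plott_outcast f_plott fSB BS) -direct_imageE.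
  exact: (subsetP (m_le B)).
have [|s [sf sm]] := IHn (S :\ x) (B :\ y) (card_step x xf).
  rewrite subsetD1 !inE -yE eqxx andbT; apply: subset_trans BS.
  by rewrite preimsetS // subsetDl.
exists (x :: s); split=> [|C CB]; first exact: cons_le.
rewrite /= inE -yE; case: ifPn => yC; last by rewrite sm // subsetD1 CB.
rewrite imset_set1 -yE; apply/eqP; rewrite eqEcard cards1 m_card andbT sub1set.
exact: (plott_heredity m_plott CB).
Qed.

End LinearLift.

Unset Implicit Arguments.
Set Strict Implicit.

Theorem theorem2 (X Y : finType) (phi : X -> Y) (f : choiceFun X)
    (f_plott : plott f) :
  Bas (direct_image phi f) = [set direct_image phi l | l in Bas f].
Proof.
apply/setP/subset_eqP/andP; split; apply/subsetP => m; last first.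
  by case/imsetP=> l lf ->; apply: direct_image_Bas.
move=> m_Bas.
have [s [sf sm]] :=
  linear_lift_word f_plott m_Bas (subsetT (phi @^-1: [set: Y])).
apply/imsetP; exists (word_choice s).
  rewrite inE word_choice_linear; apply/forallP => A.
  by rewrite word_choiceE sf ?subsetT.
apply/val_inj/ffunP => B.
by rewrite -[RHS]/(direct_image phi _ B) direct_imageE word_choiceE sm ?subsetT.
Qed.
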